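(* Let $\alpha>0$ and $\lambda>0$. If $X$ is exponentially distributed with parameter (rate) $\alpha$, and $W$ is exponentially distributed with parameter (rate) $\lambda$ and independent of $X$, then the infinite-time probability of default $\phi$ is given by $$\phi(u)=\frac{1}{\Gamma(\alpha+1)}\int_0^{\frac{\lambda u}{c}}z^\alpha e^{-z}\,dz,\qquad u\ge 0.$$
   Context: Let $c>0$ be a constant. Let $(W_i,X_i)$, $i=1,2,\dots$, be independent and identically distributed random vectors with the law of $(W,X)$. Put $T_0=0$, $T_n=W_1+\dots+W_n$. The cash flow process is $$U_t=c\sum_{n=0}^\infty 1_{[T_n,T_{n+1})}(t)\Big\{(t-T_n)e^{-\sum_{i=1}^nX_i}+\sum_{i=1}^n(T_i-T_{i-1})e^{-\sum_{k=1}^{i-1}X_k}\Big\},\quad t\ge 0,$$ with empty sums equal to $0$. Let $\tau_u$ be the first hitting time of level $u$ by $U$ (with $\tau_u=\infty$ if $u$ is never reached). The infinite-time probability of default is $\phi(u)=\mathbf{P}(\tau_u=\infty)$. *)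

(* Defs.v *)
From mathcomp Require Export all_boot all_order all_algebra.
From mathcomp Require Export finmap.
From mathcomp Require Export all_classical all_reals all_analysis.
Export Order.TTheory GRing.Theory Num.Theory.
Export numFieldNormedType.Exports.

Set Implicit Arguments.
Unset Strict Implicit.
Unset Printing Implicit Defensive.

Local Open Scope classical_set_scope.
Local Open Scope ring_scope.

(* Laws and independence only constrain measurable sets: the values of a
   measure of the library on other sets are unspecified. *)
Section laws.
Context {d d' : measure_display} {T : measurableType d}
  {S : measurableType d'} {R : realType}.
Variable P : probability T R.

Definition has_law (Y : T -> S) (mu : set S -> \bar R) : Prop :=
  forall A : set S, measurable A -> P (Y @^-1` A) = mu A.

Definition same_law (Y Z : T -> S) : Prop :=
  forall A : set S, measurable A -> P (Y @^-1` A) = P (Z @^-1` A).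

Definition independent_family (Y : nat -> T -> S) : Prop :=
  forall (J : {fset nat}) (A : nat -> set S),
    (forall i, measurable (A i)) ->
    P (\bigcap_(i in [set` J]) (Y i @^-1` A i)) =
    (\prod_(i <- J) P (Y i @^-1` A i))%E.

Definition iid_copies (Y : nat -> T -> S) (Z : T -> S) : Prop :=
  independent_family Y /\ forall i, same_law (Y i) Z.

End laws.

Definition independent_pair {d d' d'' : measure_display}
    {T : measurableType d} {S : measurableType d'} {S' : measurableType d''}
    {R : realType} (P : probability T R) (Y : T -> S) (Z : T -> S') : Prop :=
  forall (A : set S) (B : set S'), measurable A -> measurable B ->
    P (Y @^-1` A `&` Z @^-1` B) = (P (Y @^-1` A) * P (Z @^-1` B))%E.

(* The function z |-> z^(s-1) e^(-z) is integrable on ]0, +oo[ only for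
   0 < s, so this is the Gamma function for such s only. *)
Definition Gamma {R : realType} (s : R) : R :=
  \int[lebesgue_measure]_(z in `]0, +oo[) (z `^ (s - 1) * expR (- z)).

(* One path of the cash flow process, as a function of the sequences of values
   of W and X.  Indices are shifted: [w i] and [x i] stand for W_(i+1) and
   X_(i+1). *)
Section cash_flow.
Context {R : realType}.
Variables (c : R) (w x : nat -> R).

Definition arrival (n : nat) : R := \sum_(0 <= i < n) w i.

Definition discount (n : nat) : R := expR (- \sum_(0 <= i < n) x i).

Definition cash_flow_term (t : R) (n : nat) : R :=
  \1_(`[arrival n, arrival n.+1[) t *
  ((t - arrival n) * discount n +
   \sum_(0 <= i < n) (arrival i.+1 - arrival i) * discount i).

Definition cash_flow (t : R) : R := c * limn (series (cash_flow_term t)).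

(* The infimum of the empty set is +oo. *)
Definition hitting_time (u : R) : \bar R :=
  ereal_inf [set t%:E | t in [set t : R | 0 <= t /\ cash_flow t = u]].

End cash_flow.

Section default_probability.
Context {d : measure_display} {T : measurableType d} {R : realType}.
Variables (P : probability T R) (c : R) (W X : nat -> T -> R).

Definition never_hits (u : R) : set T :=
  [set omega | hitting_time c (W ^~ omega) (X ^~ omega) u = +oo%E].

(* Waiting times are only almost surely nonnegative.  On the exceptional null
   event the paths of the cash flow are arbitrary, so that [never_hits u]
   need not belong to the sigma-algebra of T, only to its completion.  Hence
   the completion of P, which coincides with P on the measurable sets of T. *)
Definition default_prob (u : R) : \bar R :=
  @completed_measure_extension d T R P (never_hits u).

End default_probability.

(* Main.v *)
Require Import Defs.
From mathcomp Require Import measurable_realfun ring lra.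

Set Implicit Arguments.
Unset Strict Implicit.
Unset Printing Implicit Defensive.

Local Open Scope classical_set_scope.
Local Open Scope ring_scope.

(** Write D_n = exp(-(X_1 + ... + X_n)) for the discount after n events and
    S_n = W_1 D_0 + ... + W_n D_(n-1), so that U equals c S_n at time T_n.  When
    all waiting times are positive, U increases continuously from 0 towards
    c sup S_n up to the supremum of the event times, hence u is never reached
    exactly when S_n <= s := u / c for all n ([hitting_time_pinfty]).  The
    probability of this event is sought.

    The renewal identity S = W + exp(-X) S' suggests that S = sup S_n has the
    Gamma law with shape alpha + 1 and rate lambda: exp(-X) is Beta(alpha, 1),
    which turns shape alpha + 1 into shape alpha, and adding an exponential
    variable restores shape alpha + 1.  In terms of the unnormalized distribution
    function F(y), the integral of z^alpha exp(-z) over [0, y], this is the pair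
    of identities [exponential_discount_incomplete_gamma] and
    [exponential_delay_incomplete_gamma], each checked by exhibiting an
    antiderivative; together they say
      E F(lambda (y - W) e^X) = F(lambda y) for every real y
    ([integral_one_period]).

    Being a fixed point does not yet identify the law of S.  Uniqueness comes from
    a martingale: the rescaled distance Y_n = (s - S_n) / D_n obeys
    Y_(n+1) = (Y_n - W_(n+1)) e^(X_(n+1)), and (W_(n+1), X_(n+1)) is independent
    of the past, so E F(lambda Y_n) = F(lambda s) for all n
    ([integral_incomplete_gamma_state]).  As n grows,
    - F(lambda Y_n) vanishes once S_n > s and is at most Gamma(alpha + 1)
      otherwise, so F(lambda s) <= Gamma(alpha + 1) P(S_n <= s for all n);
    - starting from s' > s instead, on the event that S_n <= s for all n one has
      Y_n >= (s' - s) / D_n, which tends to infinity in probability because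
      E D_n = (alpha / (alpha + 1))^n, so
      Gamma(alpha + 1) P(S_n <= s for all n) <= F(lambda s').
    Continuity of F closes the gap between the two bounds
    ([prob_bounded_forever]).  Paths with a nonpositive waiting time form a null
    set, which the completion of P ignores ([completion_null]). *)

(** * Sets that are measurable up to a null set *)

(** A set that is measurable off a null set is measurable for the completion,
    because the completion makes every subset of a null set measurable. *)
Lemma completion_null d (T : measurableType d) (R : realType)
    (mu : {measure set T -> \bar R}) (B N : set T) :
  measurable N -> mu N = 0%E -> measurable (B `\` N) ->
  (mu^*)%mu.-cara.-measurable B /\ (mu^*)%mu B = mu (B `\` N).
Proof.
move=> mN N0 mBN.
have BE : B = (B `\` N) `|` (B `&` N) by rewrite setUC setUIDK.
have BN0 : (mu^*)%mu (B `&` N) = 0%E.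
  apply/eqP; rewrite eq_le mu_ext_ge0 ?andbT//.
  by rewrite -N0 -(measurable_mu_extE mu mN) le_mu_ext.
split.
  rewrite BE; apply: measurableU.
    exact: caratheodory_measurable_mu_ext.
  apply: measure_is_complete_caratheodory; exists N; split => //.
    exact: caratheodory_measurable_mu_ext.
  by rewrite -N0; exact: measurable_mu_extE.
rewrite -(measurable_mu_extE mu mBN).
apply/eqP; rewrite eq_le [X in _ && X]le_mu_ext ?andbT//; last first.
rewrite {1}BE (le_trans (outer_measureU2 _ _ _))//=.
by rewrite BN0 adde0.
Qed.

(** * Paths of the cash flow *)

Section path.
Context {R : realType}.
Variables (c : R) (w x : nat -> R).

(** The total S_n collected up to the n-th event, per unit of c, seen as a sum of
    discounted waiting times. *)
Definition received (n : nat) : R := \sum_(0 <= i < n) w i * discount x i.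

Lemma discount_gt0 n : 0 < discount x n.
Proof. exact: expR_gt0. Qed.

Lemma cash_flow_termE t n : cash_flow_term w x t n =
  \1_(`[arrival w n, arrival w n.+1[) t *
    ((t - arrival w n) * discount x n + received n).
Proof.
rewrite /cash_flow_term; congr (_ * (_ + _)).
by apply: eq_bigr => i _; rewrite /arrival big_nat_recr//= addrAC subrr add0r.
Qed.

Hypothesis w_gt0 : forall i, 0 < w i.

Lemma arrival_homo : {homo arrival w : m n / (m <= n)%N >-> m <= n}.
Proof.
apply: homo_leq => // [? ? ?|n]; first exact: le_trans.
by rewrite /arrival big_nat_recr//= lerDl ltW.
Qed.

(** The intervals between events are disjoint, so the series defining the cash
    flow has a single nonzero term and its partial sums are eventually constant. *)
Lemma cash_flow_in t n : arrival w n <= t < arrival w n.+1 ->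
  cash_flow c w x t = c * ((t - arrival w n) * discount x n + received n).
Proof.
move=> tn; rewrite /cash_flow; congr (_ * _).
have tE m : cash_flow_term w x t m = if m == n then
    (t - arrival w n) * discount x n + received n else 0.
  rewrite cash_flow_termE indicE; case: eqVneq => [->|mn].
    by rewrite mem_set ?mul1r//= in_itv/=.
  rewrite memNset ?mul0r//= in_itv/= => /andP[mt tm].
  case/andP: tn => nt tn.
  case: (ltngtP m n) mn => // [|] /arrival_homo h _.
    by have := lt_le_trans tm (le_trans h nt); rewrite ltxx.
  by have := lt_le_trans tn (le_trans h mt); rewrite ltxx.
apply/cvg_lim => //; rewrite -(cvg_shiftn n.+1)/=.
rewrite (_ : (fun _ => _) = cst ((t - arrival w n) * discount x n + received n)).
  exact: cvg_cst.
apply/funext => k; rewrite /series/=.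
under eq_bigr do rewrite tE.
rewrite -big_mkcond/= big_nat1_eq/=.
by rewrite addnS ltnS leq_addl.
Qed.

(** If the arrival times are bounded, times beyond their supremum lie in no
    interval between events, and there the cash flow drops to 0. *)
Lemma cash_flow_out t :
  (forall n, ~~ (arrival w n <= t < arrival w n.+1)) -> cash_flow c w x t = 0.
Proof.
move=> tn; rewrite /cash_flow (_ : cash_flow_term w x t = cst 0).
  rewrite (_ : series _ = cst 0); first by rewrite lim_cst// mulr0.
  by apply/funext => n; rewrite /series/= big1.
apply/funext => n; rewrite cash_flow_termE indicE memNset ?mul0r//=.
by rewrite in_itv/=; exact/negP.
Qed.

Lemma received0 : received 0 = 0.
Proof. by rewrite /received big_geq. Qed.

Lemma receivedS n : received n.+1 = received n + w n * discount x n.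
Proof. by rewrite /received big_nat_recr. Qed.

Lemma arrival0 : arrival w 0 = 0.
Proof. by rewrite /arrival big_geq. Qed.

Lemma arrivalS n : arrival w n.+1 = arrival w n + w n.
Proof. by rewrite /arrival big_nat_recr. Qed.

(** Up to the supremum of the arrival times the cash flow is affine between events
    with values c S_n at the events, so that it takes exactly the values in
    [0, c sup S_n[; the supremum is not attained since S_n is strictly increasing.
    Bounded arrival times do no harm: the only further value is 0, which is taken
    at time 0 anyway. *)
Lemma hitting_time_pinfty u : 0 < c -> 0 <= u ->
  hitting_time c w x u = +oo%E <-> forall n, received n <= u / c.
Proof.
move=> c0 u0; split=> [/ereal_inf_pinfty hit n|le_u]; last first.
  apply/ereal_inf_pinfty => _ [t [t0 tu] <-]; exfalso.
  have [[n tn]|tn] := pselect (exists n, arrival w n <= t < arrival w n.+1).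
    have := le_u n.+1; rewrite leNgt => /negP; apply.
    rewrite -tu (cash_flow_in tn) mulrC mulKf ?gt_eqF// receivedS addrC.
    rewrite ltrD2l ltr_pM2r ?discount_gt0// ltrBlDl -arrivalS.
    by case/andP: tn.
  have u_eq0 : u = 0.
    by rewrite -tu cash_flow_out// => n; apply/negP => nt; apply: tn; exists n.
  have := le_u 1%N; rewrite receivedS received0 add0r u_eq0 mul0r leNgt.
  by rewrite mulr_gt0// discount_gt0.
rewrite leNgt; apply/negP => u_lt.
(* The level is crossed between the last event m with S_m <= u / c and the next
   one; solving the affine equation on that interval gives the hitting time. *)
have u_ltS : exists n, u / c < received n by exists n.
have [[|m]] := ex_minnP u_ltS; first by rewrite received0 ltNge divr_ge0// ltW.
rewrite receivedS => um m_min.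
have mu : received m <= u / c.
  by rewrite leNgt; apply/negP => /m_min; rewrite ltnn.
pose t := arrival w m + (u / c - received m) / discount x m.
have tm : arrival w m <= t < arrival w m.+1.
  rewrite lerDl divr_ge0 ?subr_ge0 ?(ltW (discount_gt0 _))//= arrivalS ltrD2l.
  by rewrite ltr_pdivrMr ?discount_gt0// ltrBlDl.
have t_ge0 : 0 <= t.
  by rewrite (le_trans _ (proj1 (andP tm)))// -arrival0 arrival_homo.
suff : t%:E = +oo%E by [].
apply: hit; exists t => //; split => //.
rewrite (cash_flow_in tm) /t [arrival w m + _]addrC addrK divfK ?gt_eqF ?discount_gt0//.
by rewrite subrK mulrC divfK// gt_eqF.
Qed.

End path.

(** * Independence for recursively driven processes *)

Section independence.
Context {d d1 d2 : measure_display} {T : measurableType d}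
  {S1 : measurableType d1} {S2 : measurableType d2} {R : realType}.
Variable P : probability T R.

(** The law of an independent pair is a product measure, so this is Tonelli's
    theorem; writing the second integral over T as well spares the distributions
    of Z and V in later computations. *)
Lemma independent_pair_integral (Z : T -> S1) (V : T -> S2)
    (f : S1 * S2 -> \bar R) :
  measurable_fun setT Z -> measurable_fun setT V ->
  independent_pair P Z V -> measurable_fun setT f -> (forall z, 0 <= f z)%E ->
  (\int[P]_t f (Z t, V t) = \int[P]_t \int[P]_t' f (Z t, V t'))%E.
Proof.
move=> mZ mV ZV mf f0.
pose Z' : {mfun T >-> S1} := mfun_Sub (mem_set mZ).
pose V' : {mfun T >-> S2} := mfun_Sub (mem_set mV).
have mZV : measurable_fun setT (fun t => (Z t, V t)) by exact: measurable_fun_pair.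
pose ZV' : {mfun T >-> (S1 * S2)%type} := mfun_Sub (mem_set mZV).
pose lZ := distribution P Z'; pose lV := distribution P V'.
transitivity (\int[distribution P ZV']_z f z)%E.
  by rewrite ge0_integral_distribution.
transitivity (\int[lZ \x lV]_z f z)%E.
  apply: eq_measure_integral => A mA _.
  by apply/esym/(product_measure_unique (m1 := lZ) (m2 := lV)) => // B C mB mC; exact: ZV.
rewrite fubini_tonelli1//= ge0_integral_distribution//=; last 2 first.
- exact: measurable_fun_fubini_tonelli_F.
- by move=> z; apply: integral_ge0.
apply: eq_integral => t _; rewrite /fubini_F/= ge0_integral_distribution//.
exact: measurableT_comp.
Qed.

(** Rectangles form a generating class stable under intersection, and both sides
    are finite measures in C. *)
Lemma independent_event_pair (Z : T -> S1) (V : T -> S2) (E : set T) :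
  measurable_fun setT Z -> measurable_fun setT V -> measurable E ->
  (forall A B, measurable A -> measurable B ->
    P (Z @^-1` A `&` V @^-1` B `&` E) =
    (P (Z @^-1` A `&` V @^-1` B) * P E)%E) ->
  forall C, measurable C ->
    P ((fun t => (Z t, V t)) @^-1` C `&` E) =
    (P ((fun t => (Z t, V t)) @^-1` C) * P E)%E.
Proof.
move=> mZ mV mE ZVE C mC.
have mZV : measurable_fun setT (fun t => (Z t, V t)) by exact: measurable_fun_pair.
pose ZV t := (Z t, V t).
have PE0 : 0 <= fine (P E) by exact: fine_ge0.
have PEE : P E = (NngNum PE0)%:num%:E by rewrite /= fineK// fin_num_measure.
pose m1 : {measure set (S1 * S2) -> \bar R} := pushforward (mrestr P mE) ZV.
pose m2 : {measure set (S1 * S2) -> \bar R} :=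
  mscale (NngNum PE0) (pushforward P ZV).
rewrite muleC PEE.
apply: (@measure_unique _ R (S1 * S2)%type
  [set A `*` B | A in measurable & B in measurable] (fun=> setT)
  _ _ _ _ (m1 mZV) (m2 mZV)) => //.
- by rewrite measurable_prod_measurableType.
- move=> _ _ [A mA [B mB <-]] [A' mA' [B' mB' <-]].
  rewrite -setXI; exists (A `&` A'); first exact: measurableI.
  by exists (B `&` B'); first exact: measurableI.
- by move=> _; exists setT => //; exists setT => //; rewrite setXTT.
- by rewrite bigcup_const.
- move=> _ [A mA [B mB <-]].
  rewrite [LHS](ZVE A B)// PEE muleC.
  by [].
- move=> _; rewrite (le_lt_trans _ (ltry 1))//.
  rewrite [m1 _ _](_ : _ = P (setT `&` E))//.
  by apply: probability_le1; rewrite setTI.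
Qed.

End independence.

(** A process Z driven by an independent noise V through Z_(n+1) = h(Z_n, V_n):
    Z_n is a function of the noise before n, and the induction below avoids
    handling that function. *)
Section driven.
Context {d d1 d2 : measure_display} {T : measurableType d}
  {S1 : measurableType d1} {S2 : measurableType d2} {R : realType}.
Variables (P : probability T R) (V : nat -> T -> S2) (Z : nat -> T -> S1).
Variables (h : S1 * S2 -> S1) (z0 : S1).
Hypothesis mV : forall n, measurable_fun setT (V n).
Hypothesis Vindep : independent_family P V.
Hypothesis mh : measurable_fun setT h.
Hypothesis Z0 : forall t, Z 0 t = z0.
Hypothesis ZS : forall n t, Z n.+1 t = h (Z n t, V n t).

Lemma driven_measurable n : measurable_fun setT (Z n).
Proof.
elim: n => [|n IH].
  by rewrite (_ : Z 0 = cst z0)//; apply/funext => t; rewrite Z0.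
rewrite (_ : Z n.+1 = h \o (fun t => (Z n t, V n t))).
  apply: measurableT_comp => //; exact: measurable_fun_pair.
by apply/funext => t; rewrite ZS.
Qed.

(** Independence of Z_n from V_n alone would not be inductive; independence from
    every finite part of the noise from n on is.  In the step, V_n moves from the
    future of Z_n into the pair (Z_n, V_n), which determines Z_(n+1). *)
Lemma driven_independent_future n (J : {fset nat}) (A : set S1)
    (B : nat -> set S2) :
  {in J, forall j, n <= j}%N -> measurable A -> (forall i, measurable (B i)) ->
  P (Z n @^-1` A `&` \bigcap_(i in [set` J]) (V i @^-1` B i)) =
  (P (Z n @^-1` A) * \prod_(i <- J) P (V i @^-1` B i))%E.
Proof.
elim: n J A B => [|n IH] J A B nJ mA mB.
  have [Az0|Az0] := pselect (A z0).
    rewrite [Z 0 @^-1` A](_ : _ = setT) ?setTI ?probability_setT ?mul1e ?Vindep//.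
    by apply/seteqP; split => // t _ /=; rewrite Z0.
  rewrite [Z 0 @^-1` A](_ : _ = set0) ?set0I ?measure0 ?mul0e//.
  by apply/seteqP; split => // t /=; rewrite Z0.
have -> : Z n.+1 @^-1` A = (fun t => (Z n t, V n t)) @^-1` (h @^-1` A).
  by apply/seteqP; split => t /=; rewrite ZS.
rewrite -Vindep//; apply: independent_event_pair => //.
- exact: driven_measurable.
- apply: fin_bigcap_measurable => // i _.
  by rewrite -[X in measurable X]setTI; exact: mV.
- move=> A' B' mA' mB'; rewrite Vindep//.
  have nJ' : n \notin J by apply/negP => /nJ; rewrite ltnn.
  have JE i : i \in J -> (if i == n then B' else B i) = B i.
    by move=> iJ; case: eqVneq => // iE; rewrite -iE iJ in nJ'.
  have /= := IH (n |` J)%fset A' (fun i => if i == n then B' else B i).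
  rewrite big_fsetU1//= eqxx set_fsetU1 bigcap_setU1/= eqxx setIA.
  rewrite (@eq_bigcapr _ _ _ _ (fun i => V i @^-1` B i)) => [|i /= iJ]; last first.
    by rewrite JE.
  under eq_big_seq => i iJ do rewrite JE//.
  move=> ->//; last first.
  + by move=> i; case: ifP.
  + by move=> j /fset1UP[->//|/nJ/ltnW].
  + have /= := IH [fset n]%fset A' (fun=> B').
    rewrite big_seq_fset1 set_fset1 bigcap_set1 muleA => -> //.
    by move=> j; rewrite inE => /eqP ->.
- by rewrite -[X in measurable X]setTI; exact: mh.
Qed.

Lemma driven_independent n : independent_pair P (Z n) (V n).
Proof.
move=> A B mA mB.
have := @driven_independent_future n [fset n]%fset A (fun=> B).
rewrite big_seq_fset1 set_fset1 bigcap_set1; apply => //.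
by move=> j; rewrite inE => /eqP ->.
Qed.

End driven.

(** * The incomplete Gamma function *)

Section incomplete_gamma.
Context {R : realType}.
Variable a : R.
Hypothesis a_gt0 : 0 < a.
Notation mu := (@lebesgue_measure R).

(** The integrand z^a e^(-z), extended by 0 to the negative half-line.  The
    maximum is needed because the power of a negative number is 1 here. *)
Definition gamma_kernel (z : R) : R := Num.max z 0 `^ a * expR (- z).

(** Integrating from -oo makes this function differentiable on the whole line, the
    point 0 included, so that no boundary terms have to be treated apart. *)
Definition incomplete_gamma (y : R) : R :=
  \int[mu]_(z in `]-oo, y]) gamma_kernel z.

Local Notation g := gamma_kernel.
Local Notation F := incomplete_gamma.

Lemma gamma_kernel_ge0 z : 0 <= g z.
Proof. by rewrite mulr_ge0 ?powR_ge0 ?expR_ge0. Qed.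

Lemma gamma_kernel_pos z : 0 <= z -> g z = z `^ a * expR (- z).
Proof. by move=> z0; rewrite /g max_l. Qed.

Lemma gamma_kernel_neg z : z <= 0 -> g z = 0.
Proof. by move=> z0; rewrite /g max_r// powR0 ?mul0r// gt_eqF. Qed.

Lemma continuous_gamma_kernel : continuous g.
Proof.
move=> z; apply: (@continuousM _ R^o (fun z => Num.max z 0 `^ a)); last first.
  apply: continuous_comp; last exact: continuous_expR.
  exact: (@continuousN _ R^o).
have [z0|z0|->] := ltgtP z 0.
- rewrite /prop_for /continuous_at/= max_r ?ltW// powR0 ?gt_eqF//.
  apply: cvg_near_cst.
  near=> x; rewrite max_r ?powR0 ?gt_eqF// ltW//.
  by near: x; exact: lt_nbhsl.
- rewrite /prop_for /continuous_at/= max_l ?ltW//.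
  have /@ex_derive dz := is_derive1_powR a z0.
  have pz := differentiable_continuous ((derivable1_diffP _ _).1 dz).
  apply: cvg_trans pz; apply: near_eq_cvg.
  near=> x; rewrite max_l// ltW//.
  by near: x; exact: lt_nbhsr.
- apply/left_right_continuousP; rewrite maxxx powR0 ?gt_eqF//; split.
    apply: cvg_near_cst.
    by near=> x; rewrite max_r ?powR0 ?gt_eqF.
  apply: cvg_trans (powR_cvg0 a_gt0); apply: near_eq_cvg.
  by near=> x; rewrite max_l.
Unshelve. all: by end_near. Qed.

Lemma measurable_gamma_kernel D : measurable D -> measurable_fun D g.
Proof.
move=> mD; apply: measurable_funTS.
exact: continuous_measurable_fun continuous_gamma_kernel.
Qed.

(** From t <= e^t at t = z / (2 a) one gets z^a <= (2 a)^a e^(z / 2). *)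
Lemma gamma_kernel_le z :
  g z <= (2 * a) `^ a * 2 * exponential_pdf 2^-1 z.
Proof.
have [z0|z0] := leP z 0.
  by rewrite gamma_kernel_neg// !mulr_ge0 ?powR_ge0 ?exponential_pdf_ge0.
rewrite gamma_kernel_pos ?(ltW z0)// exponential_pdfE ?(ltW z0)//.
rewrite mulrA -(mulrA _ 2) divff// mulr1.
have -> : expR (- z) = expR (- 2^-1 * z) * expR (- 2^-1 * z).
  by rewrite -expRD; congr expR; lra.
rewrite mulrA ler_pM2r ?expR_gt0//.
have a2 : 0 < 2 * a by rewrite mulr_gt0.
have -> : z = (2 * a) * (z / (2 * a)) by rewrite mulrC divfK ?gt_eqF.
have za0 : 0 <= z / (2 * a) by rewrite divr_ge0 ?ltW.
rewrite powRM ?(ltW a2)// -mulrA ler_piMr ?powR_ge0//.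
have : (z / (2 * a)) `^ a <= expR (z / (2 * a)) `^ a.
  apply: ge0_ler_powR; rewrite ?nnegrE ?expR_ge0 ?(ltW a_gt0)//.
  by rewrite (le_trans _ (expR_ge1Dx _))// lerDr.
rewrite -expRM => h; rewrite (le_trans (ler_wpM2r (expR_ge0 _) h))// -expRD.
rewrite -[leRHS]expR0 ler_expR le_eqVlt; apply/orP; left; apply/eqP.
by field; rewrite gt_eqF.
Qed.

Lemma integrable_gamma_kernel D : measurable D ->
  mu.-integrable D (EFin \o g).
Proof.
move=> mD; apply: (integrableS measurableT) => //.
have bound : mu.-integrable setT (EFin \o
    (fun z => (2 * a) `^ a * 2 * exponential_pdf 2^-1 z)).
  have /(integrableZl measurableT ((2 * a) `^ a * 2)) :=
    integrable_exponential_pdf (rate := 2^-1 : R) ltac:(by rewrite invr_gt0).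
  exact.
apply: (le_integrable _ _ _ bound) => //.
  by apply/measurable_EFinP; exact: measurable_gamma_kernel.
move=> z _; rewrite /= lee_fin ger0_norm ?gamma_kernel_ge0//.
by rewrite (le_trans (gamma_kernel_le z)) ?ler_norm.
Qed.

Global Instance is_derive_incomplete_gamma (y : R) : is_derive y 1 F (g y).
Proof.
have yS : y < y + 1 by rewrite ltrDl.
have [] := @continuous_FTC1 R g -oo%O y (y + 1) yS.
- exact: integrable_gamma_kernel.
- by rewrite ltNyr.
- exact: continuous_gamma_kernel.
move=> dF <-; rewrite derive1E; exact/derivableP.
Qed.

Lemma continuous_incomplete_gamma : continuous F.
Proof.
by move=> y; apply: differentiable_continuous; apply/derivable1_diffP.
Qed.

Lemma measurable_incomplete_gamma : measurable_fun setT F.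
Proof. exact: continuous_measurable_fun continuous_incomplete_gamma. Qed.

Lemma incomplete_gammaE y :
  F y = \int[mu]_(z in `[0, y]) (z `^ a * expR (- z)).
Proof.
rewrite /F /Rintegral; congr fine.
rewrite [LHS]integral_mkcond [RHS]integral_mkcond/=.
apply: eq_integral => z _; rewrite !patchE !mem_setE !in_itv/=.
have [zy|_] := leP z y; rewrite ?andbF ?andbT//.
by case: leP => z0; [rewrite gamma_kernel_pos|rewrite gamma_kernel_neg// ltW].
Qed.

Lemma Gamma_gamma_kernel : Gamma (a + 1) = \int[mu]_z g z.
Proof.
rewrite /Gamma /Rintegral; congr fine.
rewrite [LHS]integral_mkcond/=.
apply: eq_integral => z _; rewrite patchE !mem_setE !in_itv/= andbT addrK.
by case: ltP => z0; [rewrite gamma_kernel_pos// ltW|rewrite gamma_kernel_neg].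
Qed.

Lemma incomplete_gamma_ge0 y : 0 <= F y.
Proof. by apply: Rintegral_ge0 => z _; exact: gamma_kernel_ge0. Qed.

Lemma incomplete_gamma_EFin y :
  (F y)%:E = (\int[mu]_(z in `]-oo, y]) (g z)%:E)%E.
Proof.
by rewrite fineK//; apply: integrable_fin_num => //; exact: integrable_gamma_kernel.
Qed.

Lemma Gamma_EFin : (Gamma (a + 1))%:E = (\int[mu]_z (g z)%:E)%E.
Proof.
rewrite Gamma_gamma_kernel fineK//; apply: integrable_fin_num => //.
exact: integrable_gamma_kernel.
Qed.

Lemma incomplete_gamma_le_Gamma y : F y <= Gamma (a + 1).
Proof.
rewrite -lee_fin incomplete_gamma_EFin Gamma_EFin; apply: ge0_subset_integral => //.
  by apply/measurable_EFinP; exact: measurable_gamma_kernel.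
by move=> z _; rewrite lee_fin gamma_kernel_ge0.
Qed.

Lemma incomplete_gamma_nondecreasing : {homo F : x y / x <= y}.
Proof.
move=> x y xy.
rewrite -lee_fin !incomplete_gamma_EFin; apply: ge0_subset_integral => //.
- by apply/measurable_EFinP; exact: measurable_gamma_kernel.
- by move=> z _; rewrite lee_fin gamma_kernel_ge0.
- by apply: subset_itvl; rewrite bnd_simp.
Qed.

Lemma incomplete_gamma_le0 y : y <= 0 -> F y = 0.
Proof.
move=> y0; rewrite /F /Rintegral integral0_eq// => z /=; rewrite in_itv/= => zy.
by rewrite gamma_kernel_neg// (le_trans zy).
Qed.

Lemma incomplete_gamma_cvg : F n%:R @[n --> \oo] --> Gamma (a + 1).
Proof.
apply/fine_cvg; rewrite Gamma_EFin.
rewrite (_ : [set: measurableTypeR R] = \bigcup_n `]-oo, n%:R]%classic).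
  apply: ge0_nondecreasing_set_cvg_integral => //.
  - move=> m n mn; apply/subsetPset; apply: subset_itvl.
    by rewrite bnd_simp ler_nat.
  - by move=> n; apply/measurable_EFinP; exact: measurable_gamma_kernel.
  - by move=> n z _; rewrite lee_fin gamma_kernel_ge0.
apply/seteqP; split => // z _; exists (Num.bound `|z|) => //=.
by rewrite in_itv/= (le_trans (ler_norm _))// ltW// archi_boundP.
Qed.

(** If this value were 0, then [incomplete_gamma], which lies between 0 and it,
    would vanish identically, against its positive derivative at 1. *)
Lemma Gamma_addr1_gt0 : 0 < Gamma (a + 1).
Proof.
rewrite lt_neqAle (le_trans (incomplete_gamma_ge0 0)) ?incomplete_gamma_le_Gamma// andbT.
apply/eqP => Gamma0.
have F0 : F = cst 0.
  apply/funext => y; apply/eqP; rewrite eq_le incomplete_gamma_ge0 andbT.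
  by rewrite Gamma0 incomplete_gamma_le_Gamma.
have := @derive_val _ _ _ _ _ _ _ (is_derive_incomplete_gamma 1).
rewrite F0 derive_cst => /esym/eqP; rewrite gamma_kernel_pos// powR1 mul1r.
by rewrite gt_eqF// expR_gt0.
Qed.

Lemma integral_exponential_pdfE (r : R) (h : R -> R) :
  (\int[mu]_x (h x * exponential_pdf r x)%:E =
   \int[mu]_(x in `[0%R, +oo[) (h x * (r * expR (- r * x)))%:E)%E.
Proof.
rewrite [RHS]integral_mkcond; apply: eq_integral => x _.
rewrite /exponential_pdf !patchE; case: ifPn => // _; by rewrite mulr0.
Qed.

Lemma cvg_expRN_pinfty (r : R) : 0 < r -> expR (- r * x) @[x --> +oo] --> 0.
Proof.
move=> r0.
rewrite (_ : (fun x => expR (- r * x)) = (fun z => expR (- z)) \o (fun z => r * z)).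
  apply: (@cvg_comp _ _ _ _ _ _ (pinfty_nbhs R)); last exact: cvgr_expR.
  exact: gt0_cvgMry.
by apply/funext => x /=; rewrite mulNr.
Qed.

Lemma incomplete_gamma_expRN_cvg0 (h : R -> R) (r : R) : 0 < r ->
  F (h x) * expR (- r * x) @[x --> +oo] --> 0.
Proof.
move=> r0; apply: (squeeze_cvgr (f := cst 0)
  (h := fun x => Gamma (a + 1) * expR (- r * x))).
- apply: nearW => x; rewrite mulr_ge0 ?incomplete_gamma_ge0 ?expR_ge0//=.
  by rewrite ler_pM2r ?expR_gt0// incomplete_gamma_le_Gamma.
- exact: cvg_cst.
- rewrite -[X in _ --> X](mulr0 (Gamma (a + 1))).
  by apply: cvgMr; exact: cvg_expRN_pinfty.
Qed.

(** Averaging over the discount: for v > 0 the integrand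
    F(v e^x) a e^(-a x) has the antiderivative
    -F(v e^x) e^(-a x) - v^a e^(-v e^x), since g(v e^x) e^(-a x) = v^a e^(-v e^x).
    This antiderivative is -(F v + g v) at 0 and tends to 0 at infinity. *)
Lemma exponential_discount_incomplete_gamma v :
  (\int[mu]_x (F (v * expR x) * exponential_pdf a x)%:E = (F v + g v)%:E)%E.
Proof.
rewrite integral_exponential_pdfE.
have [v0|v0] := leP v 0.
  rewrite integral0_eq ?incomplete_gamma_le0 ?gamma_kernel_neg ?addr0// => x _.
  by rewrite incomplete_gamma_le0 ?mul0r// mulr_le0_ge0// expR_ge0.
pose A x := - (F (v * expR x) * expR (- a * x)) - v `^ a * expR (- (v * expR x)).
have dA (x : R) : is_derive x 1 A (F (v * expR x) * (a * expR (- a * x))).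
  apply: is_derive_eq.
  rewrite gamma_kernel_pos ?mulr_ge0 ?expR_ge0 ?ltW//.
  rewrite powRM ?expR_ge0 ?(ltW v0)// -expRM.
  rewrite (_ : - a * x = - (x * a)); last by rewrite mulNr mulrC.
  have := expR_gt0 (x * a); rewrite expRN => /lt0r_neq0 E0.
  by rewrite /GRing.scale/=; field.
rewrite (@ge0_continuous_FTC2y R _ A 0 0).
- rewrite -EFinB /A mulr0 !expR0 !mulr1 gamma_kernel_pos ?ltW//.
  by rewrite sub0r opprB opprK addrC.
- move=> x x0; rewrite mulr_ge0 ?incomplete_gamma_ge0// mulr_ge0 ?expR_ge0//.
  exact: ltW.
- apply: continuous_subspaceT => x.
  apply: (@continuousM _ R^o (fun x => F (v * expR x))).
    apply: continuous_comp; last exact: continuous_incomplete_gamma.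
    by apply: continuousM; [exact: cvg_cst|exact: continuous_expR].
  apply: (@continuousM _ R^o); first exact: cvg_cst.
  apply: continuous_comp; last exact: continuous_expR.
  by apply: continuousM => //; exact: cvg_cst.
- rewrite -[X in _ --> X]subr0 -[X in _ --> X - _]oppr0 -[X in _ --> _ - X](mulr0 (v `^ a)).
  apply: cvgB; first by apply: cvgN; exact: incomplete_gamma_expRN_cvg0.
  apply: cvgMr.
  have := @cvg_comp _ _ _ (fun x : R => v * expR x) (fun z : R => expR (- z)).
  apply; last exact: cvgr_expR.
  apply: gt0_cvgMry => //; apply: (ger_cvgy (f := id)); last exact: cvg_id.
  by apply: nearW => x; rewrite (le_trans _ (expR_ge1Dx _))// lerDr.
- by move=> x _; exact: (@ex_derive _ _ _ _ _ _ _ (dA x)).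
- apply: cvg_at_right_filter; apply: differentiable_continuous.
  by apply/derivable1_diffP; exact: (@ex_derive _ _ _ _ _ _ _ (dA 0)).
- by move=> x _; rewrite derive1E (@derive_val _ _ _ _ _ _ _ (dA x)).
Qed.

(** Averaging over the waiting time: since F' = g, the integrand is the derivative
    of -F(l (y - w)) e^(-l w). *)
Lemma exponential_delay_incomplete_gamma (l y : R) : 0 < l ->
  (\int[mu]_w ((F (l * (y - w)) + g (l * (y - w))) * exponential_pdf l w)%:E =
   (F (l * y))%:E)%E.
Proof.
move=> l0; rewrite integral_exponential_pdfE.
pose A w := - (F (l * (y - w)) * expR (- l * w)).
have dA (w : R) : is_derive w 1 A
    ((F (l * (y - w)) + g (l * (y - w))) * (l * expR (- l * w))).
  apply: is_derive_eq; rewrite /GRing.scale/=.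
  by ring.
rewrite (@ge0_continuous_FTC2y R _ A 0 0).
- by rewrite -EFinB /A mulr0 expR0 subr0 mulr1 sub0r opprK.
- move=> w _; rewrite mulr_ge0 ?addr_ge0 ?incomplete_gamma_ge0 ?gamma_kernel_ge0//.
  by rewrite mulr_ge0 ?expR_ge0// ltW.
- have lin : continuous (fun w : R => l * (y - w)).
    move=> w; apply: cvgMr; apply: cvgB; [exact: cvg_cst|exact: cvg_id].
  have cF : continuous (fun w : R => F (l * (y - w))).
    move=> w; apply: (@continuous_comp _ _ _ (fun w => l * (y - w)) F).
      exact: lin.
    exact: continuous_incomplete_gamma.
  have cg : continuous (fun w : R => g (l * (y - w))).
    move=> w; apply: (@continuous_comp _ _ _ (fun w => l * (y - w)) g).
      exact: lin.
    exact: continuous_gamma_kernel.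
  have cE : continuous (fun w : R => expR (- l * w)).
    move=> w; apply: (@continuous_comp _ _ _ (fun w => - l * w) expR).
      by apply: cvgMr; exact: cvg_id.
    exact: continuous_expR.
  apply: continuous_subspaceT => w; apply: cvgM; first apply: cvgD.
  - exact: cF.
  - exact: cg.
  - by apply: cvgMr; exact: cE.
- by rewrite -[X in _ --> X]oppr0; apply: cvgN; exact: incomplete_gamma_expRN_cvg0.
- by move=> w _; exact: (@ex_derive _ _ _ _ _ _ _ (dA w)).
- apply: cvg_at_right_filter; apply: differentiable_continuous.
  by apply/derivable1_diffP; exact: (@ex_derive _ _ _ _ _ _ _ (dA 0)).
- by move=> w _; rewrite derive1E (@derive_val _ _ _ _ _ _ _ (dA w)).
Qed.

End incomplete_gamma.

(** * Integrals of functions of random variables *)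

Section density.
Local Open Scope ereal_scope.
Context d (T : measurableType d) (R : realType).
Variables (mu nu : {measure set T -> \bar R}) (p : T -> R).
Hypothesis mp : measurable_fun setT p.
Hypothesis p_ge0 : forall x, (0 <= p x)%R.
Hypothesis nuE : forall A, measurable A -> nu A = \int[mu]_(x in A) (p x)%:E.

Import HBNNSimple.

(** Both sides are linear in f, and for an indicator function the claim is the
    hypothesis on nu. *)
Lemma integral_density_nnsfun (f : {nnsfun T >-> R}) :
  \int[nu]_x (f x)%:E = \int[mu]_x ((f x)%:E * (p x)%:E).
Proof.
have mE r : measurable_fun setT (fun x => (r * \1_(f @^-1` [set r]) x)%:E).
  by apply/measurable_EFinP/measurable_funM.
under [LHS]eq_integral do rewrite fimfunE -fsumEFin//.
rewrite [LHS]ge0_integral_fsum//; last first.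
  by move=> r x _; rewrite EFinM nnfun_muleindic_ge0.
under [RHS]eq_integral.
  move=> x _; rewrite fimfunE -fsumEFin// ge0_mule_fsuml; last first.
    by move=> r; rewrite EFinM nnfun_muleindic_ge0.
  over.
rewrite [RHS]ge0_integral_fsum//; last 2 first.
- by move=> r; apply: emeasurable_funM => //; exact/measurable_EFinP.
- move=> r x _; rewrite mule_ge0 ?lee_fin//.
  by rewrite -lee_fin EFinM nnfun_muleindic_ge0.
apply: eq_fsbigr => r /[!inE] -[x _ <-].
under eq_integral do rewrite EFinM.
under [RHS]eq_integral do rewrite EFinM -muleA.
rewrite !ge0_integralZl ?lee_fin//.
- congr (_ * _); rewrite integral_indic// setIT nuE// integral_mkcond.
  apply: eq_integral => y _; rewrite patchE indicE.
  by case: ifP; rewrite ?mul1e ?mul0e.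
- by apply: emeasurable_funM; apply/measurable_EFinP.
- by move=> y _; rewrite mule_ge0 ?lee_fin.
- exact/measurable_EFinP.
Qed.

Lemma ge0_integral_density (f : T -> \bar R) :
  measurable_fun setT f -> (forall x, 0 <= f x) ->
  \int[nu]_x f x = \int[mu]_x (f x * (p x)%:E).
Proof.
move=> mf f0.
pose f_ := nnsfun_approx measurableT mf.
have f_cvg x : (f_ n x)%:E @[n --> \oo] --> f x.
  exact: cvg_nnsfun_approx.
have f_nd x : {homo (fun n => (f_ n x)%:E) : m n / (m <= n)%N >-> m <= n}.
  by move=> m n mn; rewrite lee_fin; exact/lefP/nd_nnsfun_approx.
transitivity (limn (fun n => \int[nu]_x (f_ n x)%:E)).
  rewrite -monotone_convergence//.
  - by apply: eq_integral => x _; exact/esym/cvg_lim.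
  - by move=> n; exact/measurable_EFinP.
  - by move=> n x _; rewrite lee_fin.
transitivity (limn (fun n => \int[mu]_x ((f_ n x)%:E * (p x)%:E))).
  by apply: congr_lim; apply/funext => n; exact: integral_density_nnsfun.
rewrite -monotone_convergence//.
- apply: eq_integral => x _; apply/cvg_lim => //.
  by apply: cvgeZr => //; exact: f_cvg.
- by move=> n; apply: emeasurable_funM; exact/measurable_EFinP.
- by move=> n x _; rewrite mule_ge0 ?lee_fin.
- by move=> x _ m n mn; rewrite lee_wpmul2r ?lee_fin//; exact: f_nd.
Qed.

End density.

Lemma exponential_integral d (T : measurableType d) (R : realType)
    (P : probability T R) (W : {RV P >-> R}) (l : R) (f : R -> R) :
  0 < l -> has_law P W (exponential_prob l) ->
  measurable_fun setT f -> (forall x, 0 <= f x) ->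
  (\int[P]_t (f (W t))%:E =
   \int[lebesgue_measure]_x (f x * exponential_pdf l x)%:E)%E.
Proof.
move=> l0 lawW mf f0.
have mW : @measurable_fun _ _ T (measurableTypeR R) setT W.
  exact: (measurable_funP W).
pose W' : {mfun T >-> measurableTypeR R} :=
  @mfun_Sub _ _ T (measurableTypeR R) W (mem_set mW).
have mf' : @measurable_fun _ _ (measurableTypeR R) R setT f by exact: mf.
have -> : (\int[P]_t (f (W t))%:E = \int[distribution P W']_x (f x)%:E)%E.
  by rewrite ge0_integral_distribution//; exact/measurable_EFinP.
rewrite [LHS](ge0_integral_density (nu := distribution P W')
  (mu := lebesgue_measure) (p := exponential_pdf l))//.
- exact: measurable_exponential_pdf.
- by move=> x; rewrite exponential_pdf_ge0// ltW.
- exact/measurable_EFinP.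
Qed.

Lemma same_law_integral d d' (T : measurableType d) (S : measurableType d')
    (R : realType) (P : probability T R) (Y Z : T -> S) (f : S -> \bar R) :
  measurable_fun setT Y -> measurable_fun setT Z -> same_law P Y Z ->
  measurable_fun setT f -> (forall z, 0 <= f z)%E ->
  (\int[P]_t f (Y t) = \int[P]_t f (Z t))%E.
Proof.
move=> mY mZ YZ mf f0.
pose Y' : {mfun T >-> S} := mfun_Sub (mem_set mY).
pose Z' : {mfun T >-> S} := mfun_Sub (mem_set mZ).
transitivity (\int[distribution P Y']_z f z)%E.
  by rewrite ge0_integral_distribution.
transitivity (\int[distribution P Z']_z f z)%E.
  by apply: eq_measure_integral => A mA _; exact: YZ.
by rewrite ge0_integral_distribution.
Qed.

Lemma probability_integral_cst d (T : measurableType d) (R : realType)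
    (P : probability T R) (r : \bar R) : (\int[P]_t r = r)%E.
Proof.
by have /= -> := integral_cst P measurableT r; rewrite probability_setT mule1.
Qed.

(** * The law of the discounted total *)

Opaque incomplete_gamma.

Section risk_process.
Context (R : realType) (d : measure_display) (T : measurableType d)
  (P : probability T R) (alpha lambda : R)
  (W X : {RV P >-> R}) (W_ X_ : nat -> {RV P >-> R}).
Hypotheses (alpha_gt0 : 0 < alpha) (lambda_gt0 : 0 < lambda).
Hypothesis X_exp : has_law P X (exponential_prob alpha).
Hypothesis W_exp : has_law P W (exponential_prob lambda).
Hypothesis WX_indep : independent_pair P W X.
Hypothesis WX_iid : iid_copies P (fun i omega => (W_ i omega, X_ i omega))
                                 (fun omega => (W omega, X omega)).

Local Notation F := (incomplete_gamma alpha).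
Local Notation S n t := (received (W_ ^~ t) (X_ ^~ t) n).
Local Notation L n t := (\sum_(0 <= i < n) X_ i t).

(** The state is (S_n, L_n) with L_n = X_1 + ... + X_n; keeping the exponent L_n
    instead of the discount D_n = exp(-L_n) lets 1 / D_n be written exp(L_n). *)
Definition next_state (zv : (R * R) * (R * R)) : R * R :=
  (zv.1.1 + zv.2.1 * expR (- zv.1.2), zv.1.2 + zv.2.2).

Lemma measurable_next_state : measurable_fun setT next_state.
Proof.
apply: measurable_fun_pair.
  apply: measurable_funD; first exact: measurableT_comp measurable_fst measurable_fst.
  apply: measurable_funM; first exact: measurableT_comp measurable_fst measurable_snd.
  apply: measurableT_comp => //; apply: measurableT_comp => //.
  exact: measurableT_comp measurable_snd measurable_fst.
apply: measurable_funD.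
  exact: measurableT_comp measurable_snd measurable_fst.
exact: measurableT_comp measurable_snd measurable_snd.
Qed.

Lemma measurable_WX n : measurable_fun setT (fun t => (W_ n t, X_ n t)).
Proof. exact: measurable_fun_pair. Qed.

Lemma state0 t : (S 0 t, L 0 t) = (0, 0).
Proof. by rewrite received0 big_geq. Qed.

Lemma stateS n t : (S n.+1 t, L n.+1 t) = next_state ((S n t, L n t), (W_ n t, X_ n t)).
Proof. by rewrite receivedS big_nat_recr. Qed.

Lemma measurable_state n : measurable_fun setT (fun t => (S n t, L n t)).
Proof.
exact: (driven_measurable (Z := fun n t => (S n t, L n t)) measurable_WX
  measurable_next_state state0 stateS).
Qed.

(** The Markov property: given the state after n events, the next pair of waiting
    time and discount exponent is a fresh copy of (W, X). *)
Lemma integral_state_step n (f : (R * R) * (R * R) -> \bar R) :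
  measurable_fun setT f -> (forall z, 0 <= f z)%E ->
  (\int[P]_t f ((S n t, L n t), (W_ n t, X_ n t)) =
   \int[P]_t \int[P]_t' f ((S n t, L n t), (W t', X t')))%E.
Proof.
move=> mf f0.
rewrite (independent_pair_integral (P := P) (Z := fun t => (S n t, L n t))
  (V := fun t => (W_ n t, X_ n t)))//.
- apply: eq_integral => t _.
  apply: (same_law_integral (Y := fun t => (W_ n t, X_ n t))
     (Z := fun t => (W t, X t)) (f := fun v => f ((S n t, L n t), v))) => //.
  + exact: measurable_WX.
  + exact: measurable_fun_pair.
  + exact: (WX_iid.2 n).
  + exact: measurableT_comp.
- exact: measurable_state.
- exact: measurable_WX.
- exact: (driven_independent (Z := fun n t => (S n t, L n t)) measurable_WX
    WX_iid.1 measurable_next_state state0 stateS).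
Qed.

(** The Gamma law is invariant under S = W + exp(-X) S'.  The discount is averaged
    first, for a fixed waiting time. *)
Lemma integral_one_period y :
  (\int[P]_t (F (lambda * ((y - W t) * expR (X t))))%:E = (F (lambda * y))%:E)%E.
Proof.
have mF (h : R -> R) : measurable_fun setT h -> measurable_fun setT (F \o h).
  by move=> mh; apply: measurableT_comp => //; exact: measurable_incomplete_gamma.
rewrite (independent_pair_integral (P := P) (Z := W) (V := X)
  (f := fun v => (F (lambda * ((y - v.1) * expR v.2)))%:E))//=; last 2 first.
- apply/measurable_EFinP; apply: measurableT_comp; first exact: measurable_incomplete_gamma.
  apply: measurable_funM => //; apply: measurable_funM.
    by apply: measurable_funB => //; exact: measurable_fst.
  by apply: measurableT_comp => //; exact: measurable_snd.
- by move=> v; rewrite lee_fin incomplete_gamma_ge0.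
under eq_integral => t _.
  under eq_integral do rewrite mulrA.
  rewrite (exponential_integral (f := fun x => F (lambda * (y - W t) * expR x))
    alpha_gt0 X_exp); last 2 first.
  - by apply: mF; apply: measurable_funM.
  - by move=> x; exact: incomplete_gamma_ge0.
  rewrite exponential_discount_incomplete_gamma//.
  over.
rewrite (exponential_integral (f := fun w => F (lambda * (y - w)) +
   gamma_kernel alpha (lambda * (y - w))) lambda_gt0 W_exp); last 2 first.
- have ml : measurable_fun setT (fun w : R => lambda * (y - w)).
    by apply: measurable_funM => //; apply: measurable_funB.
  apply: measurable_funD; first exact: mF.
  apply: (measurableT_comp (f := gamma_kernel alpha)) => //.
  exact: measurable_gamma_kernel.
- by move=> w; rewrite addr_ge0 ?incomplete_gamma_ge0 ?gamma_kernel_ge0.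
exact: exponential_delay_incomplete_gamma.
Qed.

(** The rescaled distance to the level s evolves without reference to s. *)
Lemma remaining_step s n t :
  (s - S n.+1 t) * expR (L n.+1 t) =
  ((s - S n t) * expR (L n t) - W_ n t) * expR (X_ n t).
Proof.
rewrite receivedS big_nat_recr// expRD mulrA; congr (_ * _).
rewrite /discount expRN opprD addrA mulrBl -[W_ n t * _ * _]mulrA.
by rewrite mulVf ?mulr1// gt_eqF// expR_gt0.
Qed.

(** The martingale property: by [remaining_step] and the Markov property, one more
    event amounts to one application of [integral_one_period]. *)
Lemma integral_incomplete_gamma_state s n :
  (\int[P]_t (F (lambda * ((s - S n t) * expR (L n t))))%:E =
   (F (lambda * s))%:E)%E.
Proof.
elim: n => [|n IH].
  under eq_integral do rewrite received0 big_geq// subr0 expR0 mulr1.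
  exact: probability_integral_cst.
pose f (zv : (R * R) * (R * R)) :=
  (F (lambda * (((s - zv.1.1) * expR zv.1.2 - zv.2.1) * expR zv.2.2)))%:E.
have fE t : (F (lambda * ((s - S n.+1 t) * expR (L n.+1 t))))%:E =
    f ((S n t, L n t), (W_ n t, X_ n t)).
  by rewrite /f [fst _]/= [snd _]/= remaining_step.
under eq_integral do rewrite fE.
rewrite integral_state_step; last 2 first.
- apply/measurable_EFinP; apply: measurableT_comp; first exact: measurable_incomplete_gamma.
  apply: measurable_funM => //; apply: measurable_funM; last first.
    by apply: measurableT_comp => //; exact: measurableT_comp measurable_snd measurable_snd.
  apply: measurable_funB; last exact: measurableT_comp measurable_fst measurable_snd.
  apply: measurable_funM.
    by apply: measurable_funB => //; exact: measurableT_comp measurable_fst measurable_fst.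
  by apply: measurableT_comp => //; exact: measurableT_comp measurable_snd measurable_fst.
- by move=> z; rewrite lee_fin incomplete_gamma_ge0.
rewrite -IH; apply: eq_integral => t _.
exact: (integral_one_period ((s - S n t) * expR (L n t))).
Qed.

(** One discount factor has mean E exp(-X) = alpha / (alpha + 1), because
    exp(-x) times the exponential density of rate alpha is a multiple of the
    density of rate alpha + 1. *)
Lemma integral_discount n :
  (\int[P]_t (expR (- L n t))%:E = ((alpha / (alpha + 1)) ^+ n)%:E)%E.
Proof.
elim: n => [|n IH].
  under eq_integral do rewrite big_geq// oppr0 expR0.
  by rewrite probability_integral_cst expr0.
have mE : measurable_fun setT (fun t => (expR (- L n t))%:E).
  apply/measurable_EFinP; apply: measurableT_comp => //.
  apply: measurableT_comp => //.
  exact: measurableT_comp measurable_snd (measurable_state n).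
have one : (\int[P]_t (expR (- X t))%:E = (alpha / (alpha + 1))%:E)%E.
  rewrite (exponential_integral (f := fun x => expR (- x)) alpha_gt0 X_exp); last 2 first.
  - by apply: measurableT_comp.
  - by move=> x; exact: expR_ge0.
  transitivity (\int[lebesgue_measure]_x
    ((alpha / (alpha + 1))%:E * (exponential_pdf (alpha + 1) x)%:E))%E.
    apply: eq_integral => x _; rewrite -EFinM; congr EFin.
    rewrite /exponential_pdf !patchE; case: ifPn => _; last by rewrite !mulr0.
    rewrite [RHS]mulrA divfK ?gt_eqF ?addr_gt0// mulrCA -expRD.
    by congr (_ * expR _); ring.
  rewrite ge0_integralZl//.
  - by rewrite integral_exponential_pdf ?mule1// addr_gt0.
  - by apply/measurable_EFinP; exact: measurable_exponential_pdf.
  - by move=> x _; rewrite lee_fin exponential_pdf_ge0// addr_ge0// ltW.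
  - by rewrite lee_fin divr_ge0// ltW// addr_gt0.
pose f (zv : (R * R) * (R * R)) := (expR (- zv.1.2) * expR (- zv.2.2))%:E.
have fE t : (expR (- L n.+1 t))%:E = f ((S n t, L n t), (W_ n t, X_ n t)).
  by rewrite /f /= big_nat_recr//= opprD expRD.
under eq_integral do rewrite fE.
rewrite integral_state_step; last 2 first.
- apply/measurable_EFinP; apply: measurable_funM.
    apply: measurableT_comp => //; apply: measurableT_comp => //.
    exact: measurableT_comp measurable_snd measurable_fst.
  apply: measurableT_comp => //; apply: measurableT_comp => //.
  exact: measurableT_comp measurable_snd measurable_snd.
- by move=> z; rewrite lee_fin mulr_ge0 ?expR_ge0.
rewrite exprSr EFinM -IH -ge0_integralZr//; last first.
  by rewrite lee_fin divr_ge0// ltW// addr_gt0.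
apply: eq_integral => t _; rewrite /f/=.
under eq_integral do rewrite EFinM.
rewrite ge0_integralZl//=.
- by rewrite one.
- by apply/measurable_EFinP; do 2 apply: measurableT_comp => //.
Qed.

Definition nonpositive_wait : set T := \bigcup_n (W_ n @^-1` `]-oo, 0]).

Lemma measurable_nonpositive_wait : measurable nonpositive_wait.
Proof.
by apply: bigcup_measurable => n _; rewrite -[X in measurable X]setTI; exact: measurable_funP.
Qed.

Lemma nonpositive_wait_null : P nonpositive_wait = 0%E.
Proof.
apply: measure_negligible; first exact: measurable_nonpositive_wait.
apply: negligible_bigcup => n; apply/negligibleP.
  by rewrite -[X in measurable X]setTI; exact: measurable_funP.
have := WX_iid.2 n (`]-oo, 0] `*` setT) ltac:(exact: measurableX).
have W0 (V : T -> R) (Y : T -> R) :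
    (fun t => (V t, Y t)) @^-1` (`]-oo, 0] `*` setT) = V @^-1` `]-oo, 0].
  by apply/seteqP; split => t //= -[].
rewrite !W0 => PW; transitivity (P (W @^-1` `]-oo, 0])); first exact: PW.
rewrite W_exp// /exponential_prob -integral_itv_bndo_bndc.
  rewrite integral0_eq// => x /=; rewrite in_itv/= => x0.
  by rewrite lt0_exponential_pdf.
apply/measurable_EFinP; apply: measurable_funTS; exact: measurable_exponential_pdf.
Qed.

(** Off the null set of nonpositive waiting times these events decrease with n,
    which gives access to continuity of P from above. *)
Definition bounded_until s n : set T := [set t | S n t <= s] `\` nonpositive_wait.

Lemma measurable_received n : measurable_fun setT (fun t => S n t).
Proof. exact: measurableT_comp measurable_fst (measurable_state n). Qed.

Lemma measurable_cumulated n : measurable_fun setT (fun t => L n t).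
Proof. exact: measurableT_comp measurable_snd (measurable_state n). Qed.

Lemma measurable_received_le s n : measurable [set t | S n t <= s].
Proof.
rewrite (_ : [set _ | _] = (fun t => S n t) @^-1` `]-oo, s]).
  by rewrite -[X in measurable X]setTI; exact: measurable_received.
by apply/seteqP; split => t /=; rewrite in_itv.
Qed.

Lemma measurable_bounded_until s n : measurable (bounded_until s n).
Proof.
apply: measurableD; first exact: measurable_received_le.
exact: measurable_nonpositive_wait.
Qed.

Lemma positive_wait t : ~ nonpositive_wait t -> forall n, 0 < W_ n t.
Proof.
move=> tN n; rewrite ltNge; apply/negP => Wn; by apply: tN; exists n.
Qed.

Lemma bounded_until_nonincreasing s : nonincreasing_seq (bounded_until s).
Proof.
apply/nonincreasing_seqP => n; apply/subsetPset => t [/= Sn tN]; split => //=.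
rewrite (le_trans _ Sn)// receivedS lerDl mulr_ge0 ?expR_ge0// ltW//.
exact: positive_wait.
Qed.

Lemma measurable_remaining s n :
  measurable_fun setT (fun t => F (lambda * ((s - S n t) * expR (L n t)))).
Proof.
apply: measurableT_comp; first exact: measurable_incomplete_gamma.
apply: measurable_funM => //; apply: measurable_funM.
  by apply: measurable_funB => //; exact: measurable_received.
by apply: measurableT_comp => //; exact: measurable_cumulated.
Qed.

(** The upper estimate F(lambda Y_n) <= Gamma(alpha + 1) 1_(S_n <= s), averaged. *)
Lemma incomplete_gamma_le_prob s n :
  ((F (lambda * s))%:E <= (Gamma (alpha + 1))%:E * P (bounded_until s n))%E.
Proof.
have G0 := Gamma_addr1_gt0 alpha_gt0.
have PE : (P [set t | (S n t <= s)%R] <= P (bounded_until s n))%E.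
  rewrite (measureDI P (measurable_received_le s n) measurable_nonpositive_wait).
  rewrite [X in (_ + X)%E](_ : _ = 0%E) ?adde0//.
  apply/eqP; rewrite eq_le measure_ge0 andbT -nonpositive_wait_null.
  apply: le_measure => //; rewrite inE.
    apply: measurableI; first exact: measurable_received_le.
    exact: measurable_nonpositive_wait.
  exact: measurable_nonpositive_wait.
rewrite -(integral_incomplete_gamma_state s n).
apply: (le_trans _ (lee_wpmul2l _ PE)); last by rewrite lee_fin ltW.
have -> : P [set t | S n t <= s] = (\int[P]_t (\1_[set t | S n t <= s] t)%:E)%E.
  by rewrite integral_indic ?setIT//; exact: measurable_received_le.
rewrite -ge0_integralZl//=.
- apply: ge0_le_integral; first exact: measurableT.
  + by move=> t _; rewrite lee_fin incomplete_gamma_ge0.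
  + by apply/measurable_EFinP; exact: measurable_remaining.
  + apply: emeasurable_funM => //; apply/measurable_EFinP.
    by apply: measurable_indic; exact: measurable_received_le.
  + move=> t _; rewrite -EFinM lee_fin indicE.
    have [Ss|Ss] := leP (S n t) s.
      by rewrite mem_set ?mulr1 ?incomplete_gamma_le_Gamma.
    rewrite memNset => [|/=]; last by apply/negP; rewrite -ltNge.
    rewrite mulr0 incomplete_gamma_le0// mulr_ge0_le0 ?(ltW lambda_gt0)//.
    by rewrite mulr_le0_ge0 ?expR_ge0// subr_le0 ltW.
- by apply/measurable_EFinP; apply: measurable_indic; exact: measurable_received_le.
- by rewrite lee_fin ltW.
Qed.

Definition bounded_forever s : set T := \bigcap_n bounded_until s n.

Lemma measurable_bounded_forever s : measurable (bounded_forever s).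
Proof. by apply: bigcapT_measurable => n; exact: measurable_bounded_until. Qed.

Lemma incomplete_gamma_le_prob_forever s :
  ((F (lambda * s))%:E <= (Gamma (alpha + 1))%:E * P (bounded_forever s))%E.
Proof.
have cP : ((Gamma (alpha + 1))%:E * P (bounded_until s n) @[n --> \oo] -->
    (Gamma (alpha + 1))%:E * P (bounded_forever s))%E.
  apply: cvgeZl => //; apply: nonincreasing_cvg_mu.
  - by rewrite (le_lt_trans (probability_le1 _ _)) ?ltry//; exact: measurable_bounded_until.
  - exact: measurable_bounded_until.
  - exact: measurable_bounded_forever.
  - exact: bounded_until_nonincreasing.
rewrite -(cvg_lim _ cP)//; apply: lime_ge; first by apply/cvg_ex; eexists; exact: cP.
by apply: nearW => n; exact: incomplete_gamma_le_prob.
Qed.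

(** On the event that S_n <= s for all n, either lambda Y_n >= k for the process
    started from s', or D_n > lambda (s' - s) / k.  Both cases are covered by
      F(k) <= F(lambda Y_n) + F(k) (k / (lambda (s' - s))) D_n,
    whose last term has vanishing mean; this is Markov's inequality in disguise. *)
Lemma prob_forever_le s s' k n : s < s' -> 0 < k ->
  ((F k)%:E * P (bounded_forever s) <= (F (lambda * s') +
    F k * (k / (lambda * (s' - s))) * (alpha / (alpha + 1)) ^+ n)%:E)%E.
Proof.
move=> ss' k0; have d0 : 0 < lambda * (s' - s) by rewrite mulr_gt0// subr_gt0.
set C := F k * _.
have C0 : 0 <= C by rewrite mulr_ge0 ?incomplete_gamma_ge0// divr_ge0 ?ltW.
have -> : P (bounded_forever s) = (\int[P]_t (\1_(bounded_forever s) t)%:E)%E.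
  by rewrite integral_indic ?setIT//; exact: measurable_bounded_forever.
have mD : measurable_fun setT (fun t => (expR (- L n t))%:E).
  apply/measurable_EFinP; apply: measurableT_comp => //.
  by apply: measurableT_comp => //; exact: measurable_cumulated.
rewrite EFinD EFinM -integral_discount -(integral_incomplete_gamma_state s' n).
rewrite -!ge0_integralZl//=; last 2 first.
- by apply/measurable_EFinP; apply: measurable_indic; exact: measurable_bounded_forever.
- by rewrite lee_fin incomplete_gamma_ge0.
rewrite -ge0_integralD//; last 4 first.
- by move=> t _; rewrite lee_fin incomplete_gamma_ge0.
- by apply/measurable_EFinP; exact: measurable_remaining.
- by move=> t _; rewrite mule_ge0 ?lee_fin ?expR_ge0.
- exact: emeasurable_funM.
apply: ge0_le_integral; first exact: measurableT.
- by move=> t _; rewrite mule_ge0 ?lee_fin ?incomplete_gamma_ge0.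
- apply: emeasurable_funM => //; apply/measurable_EFinP; apply: measurable_indic.
  exact: measurable_bounded_forever.
- apply: emeasurable_funD; last exact: emeasurable_funM.
  by apply/measurable_EFinP; exact: measurable_remaining.
move=> t _; rewrite -!EFinM -EFinD lee_fin indicE.
have CD0 : 0 <= C * expR (- L n t) by rewrite mulr_ge0 ?expR_ge0.
have [/set_mem/(_ n I)[/= Ss _]|_] := boolP (t \in bounded_forever s); last first.
  by rewrite mulr0 addr_ge0 ?incomplete_gamma_ge0.
rewrite mulr1.
have [kd|kd] := leP k (lambda * (s' - s) * expR (L n t)).
  apply: ler_wpDr => //; apply: incomplete_gamma_nondecreasing => //.
  rewrite (le_trans kd)// -mulrA ler_pM2l// ler_pM2r ?expR_gt0//.
  by rewrite lerD2l lerN2.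
apply: ler_wpDl; first exact: incomplete_gamma_ge0.
rewrite /C -mulrA ler_peMr ?incomplete_gamma_ge0//.
by rewrite expRN -mulrA -invfM ler_pdivlMr ?mul1r ?ltW// mulr_gt0// expR_gt0.
Qed.

(** The lower bound is [incomplete_gamma_le_prob_forever].  The upper bound comes
    from [prob_forever_le] by letting n, then k tend to infinity, and finally s'
    decrease to s. *)
Lemma prob_bounded_forever s : P (bounded_forever s) =
  ((Gamma (alpha + 1))^-1 * F (lambda * s))%:E.
Proof.
have G0 := Gamma_addr1_gt0 alpha_gt0.
have Pfin : P (bounded_forever s) \is a fin_num.
  by apply: fin_num_measure; exact: measurable_bounded_forever.
set p := fine (P (bounded_forever s)).
have PE : P (bounded_forever s) = p%:E by rewrite fineK.
rewrite PE; congr EFin; apply/eqP; rewrite eq_le; apply/andP; split; last first.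
  rewrite ler_pdivrMl// -lee_fin EFinM -PE.
  exact: incomplete_gamma_le_prob_forever.
rewrite (ler_pdivlMl _ _ G0).
have q1 : `|alpha / (alpha + 1)| < 1.
  by rewrite ger0_norm ?divr_ge0 ?addr_ge0 ?ltW// ltr_pdivrMr ?addr_gt0// mul1r ltrDl.
have Fk s' k : s < s' -> 0 < k -> F k * p <= F (lambda * s').
  move=> ss' k0; set C := F k * (k / (lambda * (s' - s))).
  have cu : F (lambda * s') + C * (alpha / (alpha + 1)) ^+ n @[n --> \oo] -->
      F (lambda * s').
    rewrite -[X in _ --> X]addr0; apply: cvgD; first exact: cvg_cst.
    by rewrite -[X in _ --> X](mulr0 C); apply: cvgMr; exact: cvg_expr.
  apply: (cvgr_to_ge cu); apply: nearW => n.
  by rewrite -lee_fin EFinM -PE; exact: prob_forever_le.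
have Gs s' : s < s' -> Gamma (alpha + 1) * p <= F (lambda * s').
  move=> ss'.
  have cF : F n%:R * p @[n --> \oo] --> Gamma (alpha + 1) * p.
    by apply: cvgMl; exact: incomplete_gamma_cvg.
  apply: (cvgr_to_le cF); near=> n; apply: Fk => //.
  by rewrite ltr0n; near: n; exists 1%N.
have cs : F (lambda * s') @[s' --> s^'+] --> F (lambda * s).
  apply: cvg_at_right_filter.
  apply: (@continuous_comp _ _ _ (fun s' : R => lambda * s') F).
    by apply: cvgMr; exact: cvg_id.
  exact: continuous_incomplete_gamma.
apply: (cvgr_to_ge cs); near=> s'; apply: Gs; near: s'; exact: nbhs_right_gt.
Unshelve. all: by end_near. Qed.

End risk_process.

Theorem proposition4p1 (R : realType) (d : measure_display)
    (T : measurableType d) (P : probability T R)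
    (c alpha lambda : R)
    (W X : {RV P >-> R}) (W_ X_ : nat -> {RV P >-> R})
    (c_gt0 : 0 < c) (alpha_gt0 : 0 < alpha) (lambda_gt0 : 0 < lambda)
    (X_exp : has_law P X (exponential_prob alpha))
    (W_exp : has_law P W (exponential_prob lambda))
    (WX_indep : independent_pair P W X)
    (WX_iid : iid_copies P (fun i omega => (W_ i omega, X_ i omega))
                           (fun omega => (W omega, X omega)))
    (u : R) (u_ge0 : 0 <= u) :
  (P^*)%mu.-cara.-measurable (never_hits c W_ X_ u) /\
  default_prob P c W_ X_ u =
    ((Gamma (alpha + 1))^-1 *
     \int[lebesgue_measure]_(z in `[0, lambda * u / c])
        (z `^ alpha * expR (- z)))%:E.
Proof.
have never_hitsE : never_hits c W_ X_ u `\` nonpositive_wait W_ =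
    bounded_forever W_ X_ (u / c).
  apply/seteqP; split => t.
    move=> [hit tN] n _; split => //=; move: n.
    by apply/(hitting_time_pinfty (X_ ^~ t) (positive_wait tN) c_gt0 u_ge0).
  move=> tb; have tN : ~ nonpositive_wait W_ t by have [] := tb 0 I.
  split => //; apply/(hitting_time_pinfty (X_ ^~ t) (positive_wait tN) c_gt0 u_ge0).
  by move=> n; have [] := tb n I.
have [] := completion_null (mu := P) (measurable_nonpositive_wait W_)
  (nonpositive_wait_null W_exp WX_iid) (B := never_hits c W_ X_ u).
  by rewrite never_hitsE; exact: measurable_bounded_forever.
move=> mB PB; split => //.
rewrite /default_prob /completed_measure_extension PB never_hitsE.
apply: etrans (prob_bounded_forever alpha_gt0 lambda_gt0 X_exp W_exp WX_indep WX_iid _) _.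
by rewrite incomplete_gammaE// mulrA.
Qed.
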